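(* There is an absolute constant $K_1>0$ such that the following holds. Let $r=r(n)$ satisfy $r \geq K_1 (\log n/n)^{1/4}$ and let $G \in \mathcal{G}(n,r)$. Then $c(G) \leq 2$ with probability tending to $1$ as $n\to\infty$.
   Context: $\mathcal{G}(n,r)$ denotes the random geometric graph $G(x_1,\dots,x_n;r)$ where $x_1,\dots,x_n$ are chosen independently and uniformly at random from $[0,1]^2$, and $x_i,x_j$ ($i\ne j$) are adjacent iff $\|x_i-x_j\|\le r$ (Euclidean norm). Game of cops and robbers on a finite graph: cops choose starting vertices, then the robber; players alternate turns, each agent moving to an adjacent vertex or staying put (cops move simultaneously; full information); cops win if some cop eventually occupies the robber's vertex. The cop number $c(G)$ is the minimum number of cops having a strategy that wins against every robber strategy. *)

(* Defs.v *)
From Stdlib Require Import Reals List.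
Open Scope R_scope.

(* x_i = (fst (x i), snd (x i)) for i < n; values at i >= n are irrelevant. *)
Definition euclid (p q : R * R) : R :=
  sqrt ((fst p - fst q) ^ 2 + (snd p - snd q) ^ 2).

Definition rgg_adj (n : nat) (x : nat -> R * R) (r : R) (u v : nat) : Prop :=
  (u < n)%nat /\ (v < n)%nat /\ u <> v /\ euclid (x u) (x v) <= r.

(* A game state: positions of the cops (cop i for i < k) and of the robber. *)
Definition state : Type := ((nat -> nat) * nat)%type.

Definition step_ok (adj : nat -> nat -> Prop) (u u' : nat) : Prop :=
  u' = u \/ adj u u'.

(* Cop strategy (with full information / history dependence):
   - cinit : initial positions of the cops;
   - cnext h : new cop positions, given the history h (list of states,
     most recent first). *)
Record cop_strategy : Type := CopStrat {
  cinit : nat -> nat;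
  cnext : list state -> nat -> nat }.

(* Robber strategy:
   - rinit c : robber start, chosen after seeing the cops' start c;
   - rnext h c : robber's new position given history h and the cops'
     positions c just after their move. *)
Record robber_strategy : Type := RobStrat {
  rinit : (nat -> nat) -> nat;
  rnext : list state -> (nat -> nat) -> nat }.

Definition dummy_state : state := (fun _ => 0%nat, 0%nat).

(* Legality (staying put is always allowed, so requiring legality on every
   history is no restriction). *)
Definition cop_legal (n k : nat) (adj : nat -> nat -> Prop) (s : cop_strategy) : Prop :=
  (forall i, (i < k)%nat -> (cinit s i < n)%nat) /\
  (forall h i, (i < k)%nat ->
     step_ok adj (fst (hd dummy_state h) i) (cnext s h i)).

Definition robber_legal (n : nat) (adj : nat -> nat -> Prop) (s : robber_strategy) : Prop :=
  (forall c, (rinit s c < n)%nat) /\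
  (forall h c, step_ok adj (snd (hd dummy_state h)) (rnext s h c)).

Fixpoint play (cs : cop_strategy) (rs : robber_strategy) (t : nat) : list state :=
  match t with
  | O => (cinit cs, rinit rs (cinit cs)) :: nil
  | S t' =>
      let h := play cs rs t' in
      let c := cnext cs h in
      (c, rnext rs h c) :: h
  end.

(* Capture: at some moment some cop occupies the robber's vertex, either
   after the robber's placement/move, or right after the cops' move. *)
Definition captured (k : nat) (cs : cop_strategy) (rs : robber_strategy) : Prop :=
  exists t i, (i < k)%nat /\
    let st := hd dummy_state (play cs rs t) in
    (fst st i = snd st \/ cnext cs (play cs rs t) i = snd st).

Definition cops_win (n : nat) (adj : nat -> nat -> Prop) (k : nat) : Prop :=
  exists cs, cop_legal n k adj cs /\
    forall rs, robber_legal n adj rs -> captured k cs rs.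

Definition cop_number_le (n : nat) (adj : nat -> nat -> Prop) (m : nat) : Prop :=
  exists k, (k <= m)%nat /\ cops_win n adj k.

Fixpoint prodR (n : nat) (f : nat -> R) : R :=
  match n with O => 1 | S m => prodR m f * f m end.

Fixpoint sumR (m : nat) (f : nat -> R) : R :=
  match m with O => 0 | S m' => sumR m' f + f m' end.

Record box : Type := Box { lo : nat -> R * R; hi : nat -> R * R }.

Definition box_ok (n : nat) (B : box) : Prop :=
  forall i, (i < n)%nat ->
    fst (lo B i) <= fst (hi B i) /\ snd (lo B i) <= snd (hi B i).

Definition in_box (n : nat) (B : box) (x : nat -> R * R) : Prop :=
  forall i, (i < n)%nat ->
    fst (lo B i) <= fst (x i) <= fst (hi B i) /\
    snd (lo B i) <= snd (x i) <= snd (hi B i).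

Definition box_vol (n : nat) (B : box) : R :=
  prodR n (fun i => (fst (hi B i) - fst (lo B i)) * (snd (hi B i) - snd (lo B i))).

Definition outer_measure_lt (n : nat) (S : (nat -> R * R) -> Prop) (eps : R) : Prop :=
  exists (Bs : nat -> box) (s : R),
    (forall j, box_ok n (Bs j)) /\
    (forall m, sumR m (fun j => box_vol n (Bs j)) <= s) /\ s < eps /\
    (forall x, S x -> exists j, in_box n (Bs j) x).

Definition in_unit_square_n (n : nat) (x : nat -> R * R) : Prop :=
  forall i, (i < n)%nat -> 0 <= fst (x i) <= 1 /\ 0 <= snd (x i) <= 1.

(* The bad event {c(G(n,r)) > 2} as a subset of the sample space [0,1]^(2n)
   (uniform distribution = Lebesgue measure on [0,1]^(2n)). *)
Definition bad_event (n : nat) (r : R) : (nat -> R * R) -> Prop :=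
  fun x => in_unit_square_n n x /\ ~ cop_number_le n (rgg_adj n x r) 2.

(* Main.v *)
Require Import Defs.
From Stdlib Require Import Reals ZArith List Lra Lia ClassicalEpsilon.
Open Scope R_scope.

(* Cut the unit square into m^2 cells of side h = 1/m with m^2 close to
   n / (2 ln n); with high probability every cell contains a vertex, so the
   vertices form a d-net with d = 2h, and K1 is chosen so that d <= r^2 / 50000.

   Cop 0 first walks along the bottom edge until he has the robber's abscissa.
   From then on, when the robber moves by (dx, dy), he copies dx and uses the
   remaining length sqrt (r^2 - dx^2) to climb towards the robber, keeping a
   safety distance r/8.  Cop 1 does the same with the coordinates exchanged.
   As dx^2 + dy^2 <= r^2, we have
     sqrt (r^2 - dx^2) + sqrt (r^2 - dy^2) >= r,
   so the height of cop 0 plus the abscissa of cop 1 grows by at least r/4 per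
   round and the robber is caught within O(1/r) rounds.  Replacing ideal
   positions by vertices costs O(d) per round, hence O(d/r), a small multiple of
   r, in total: this is why d = O(r^2), i.e. the exponent 1/4, suffices. *)

(** * Geometry of a single cop *)

(** [b] is the cop's height, [lag] his horizontal error, [s] the climb that copying [dx] leaves him.
    Being out of reach forces the square of the new height difference [y0 + dy - b] above [s ^ 2]
    minus a small multiple of [r ^ 2]. A negative difference is no way out: a robber dropping past
    the cop from height [r / 16] or more above him lands within reach, and below a cop at height at
    most [eta] there is no room. *)
Lemma mirror_gap (r eta b y0 dx dy lag s : R) :
  0 < r -> 0 <= eta <= r / 1000 -> 0 <= s -> s ^ 2 = r ^ 2 - dx ^ 2 ->
  dx ^ 2 + dy ^ 2 <= r ^ 2 -> - eta <= lag <= eta -> 0 <= y0 + dy ->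
  (r / 8 - eta <= y0 - b \/ b <= eta) ->
  r ^ 2 < (dx + lag) ^ 2 + (y0 + dy - b) ^ 2 ->
  s - r / 8 <= y0 + dy - b.
Proof.
  intros Hr Heta Hs Es Hd Hlag Hy Hinv Hfar.
  assert (Hdx : - r <= dx <= r) by nra.
  assert (Hcross : 2 * dx * lag + lag ^ 2 <= 3 / 1000 * r ^ 2).
  { assert (dx * lag <= r * eta) by nra. assert (lag ^ 2 <= eta ^ 2) by nra.
    assert (r * eta <= r ^ 2 / 1000) by nra. assert (eta ^ 2 <= r * eta) by nra. nra. }
  set (w := y0 + dy - b) in *.
  assert (Hw : s ^ 2 - 3 / 1000 * r ^ 2 < w ^ 2) by nra.
  destruct (Rle_dec (s - r / 8) w) as [|Hn]; [assumption|exfalso].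
  destruct (Rle_dec 0 w) as [Hw0|Hw0].
  - assert (w ^ 2 <= (s - r / 8) ^ 2) by nra. nra.
  - destruct Hinv as [HD|Hb].
    + assert (HD' : r / 16 <= y0 - b) by lra.
      assert (dy < - (y0 - b)) by (unfold w in Hw0; lra).
      assert (r ^ 2 < dx ^ 2 + dy ^ 2 + 3 / 1000 * r ^ 2 + (y0 - b) * (y0 - b + 2 * dy))
        by (unfold w in Hfar; nra).
      assert ((y0 - b) * (y0 - b + 2 * dy) <= - (y0 - b) ^ 2) by nra.
      assert ((r / 16) ^ 2 <= (y0 - b) ^ 2) by nra. nra.
    + assert (- eta <= w) by (unfold w; lra).
      assert (w ^ 2 <= eta ^ 2) by nra.
      assert (eta ^ 2 <= r ^ 2 / 1000) by nra.
      assert (r / 10 <= s) by lra. assert ((r / 10) ^ 2 <= s ^ 2) by nra. nra.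
Qed.

Definition dist2 (p q : R * R) : R := (fst p - fst q) ^ 2 + (snd p - snd q) ^ 2.

Lemma euclid_le_iff (p q : R * R) (r : R) :
  0 <= r -> (euclid p q <= r <-> dist2 p q <= r ^ 2).
Proof.
  intros Hr. unfold euclid. fold (dist2 p q).
  assert (H0 : 0 <= dist2 p q) by (apply Rplus_le_le_0_compat; apply pow2_ge_0).
  pose proof (pow2_ge_0 r) as H2.
  rewrite <- (sqrt_pow2 r Hr) at 1. split; intros H.
  - apply sqrt_le_0; assumption.
  - apply sqrt_le_1; assumption.
Qed.

Lemma dist2_triangle (p q z : R * R) (s d : R) :
  0 <= s -> 0 <= d -> dist2 p q <= s ^ 2 -> dist2 q z <= d ^ 2 ->
  dist2 p z <= (s + d) ^ 2.
Proof.
  unfold dist2. intros Hs Hd.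
  replace (fst p - fst z) with ((fst p - fst q) + (fst q - fst z)) by ring.
  replace (snd p - snd z) with ((snd p - snd q) + (snd q - snd z)) by ring.
  generalize (fst p - fst q) (fst q - fst z) (snd p - snd q) (snd q - snd z).
  intros a b c e H1 H2.
  assert (H : a * b + c * e <= s * d); [|nra].
  apply Rsqr_incr_0_var; [unfold Rsqr|apply Rmult_le_pos; assumption].
  assert ((a * b + c * e) * (a * b + c * e) <= (a ^ 2 + c ^ 2) * (b ^ 2 + e ^ 2))
    by (pose proof (pow2_ge_0 (a * e - b * c)); nra).
  assert ((a ^ 2 + c ^ 2) * (b ^ 2 + e ^ 2) <= s ^ 2 * d ^ 2).
  { apply Rmult_le_compat; try assumption;
      apply Rplus_le_le_0_compat; apply pow2_ge_0. }
  nra.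
Qed.

Definition in_unit_square (p : R * R) : Prop :=
  0 <= fst p <= 1 /\ 0 <= snd p <= 1.

(* The cop at [p] is below the robber at [q], up to an error [eta]: either at a
   safe distance, or so close to the bottom edge that the robber cannot slip
   under him. *)
Definition aligned (r eta : R) (p q : R * R) : Prop :=
  - eta <= fst q - fst p <= eta /\
  (r / 8 - eta <= snd q - snd p \/ snd p <= eta).

Lemma sq_le_abs (v d : R) : 0 <= d -> v ^ 2 <= d ^ 2 -> - d <= v <= d.
Proof. intros. split; nra. Qed.

Lemma sq_between (v w : R) :
  0 <= v <= w \/ w <= v <= 0 -> v ^ 2 <= w ^ 2.
Proof. intros [H|H]; nra. Qed.

Lemma dist2_coords (p q : R * R) (d : R) :
  0 <= d -> dist2 p q <= d ^ 2 ->
  - d <= fst q - fst p <= d /\ - d <= snd q - snd p <= d.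
Proof.
  unfold dist2. intros Hd H.
  pose proof (pow2_ge_0 (fst p - fst q)). pose proof (pow2_ge_0 (snd p - snd q)).
  assert (- d <= fst p - fst q <= d) by (apply sq_le_abs; lra).
  assert (- d <= snd p - snd q <= d) by (apply sq_le_abs; lra).
  lra.
Qed.

Lemma scale_le (theta v r d : R) :
  0 <= theta <= 1 -> theta * r = r - d -> - r <= v <= r ->
  - d <= (1 - theta) * v <= d.
Proof. intros. split; nra. Qed.

Lemma abs_scale_sq (theta v w : R) :
  0 <= theta -> - v <= w <= v -> (theta * w) ^ 2 <= (theta * v) ^ 2.
Proof.
  intros. replace ((theta * w) ^ 2) with (theta ^ 2 * w ^ 2) by ring.
  replace ((theta * v) ^ 2) with (theta ^ 2 * v ^ 2) by ring.
  apply Rmult_le_compat_l; nra.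
Qed.

(** The ideal reply copies the robber's horizontal move and climbs by [g]. Shrinking it to length
    [r - d] and rounding to a vertex each cost at most [d], whence the [2 * d]. The climb is at
    least [s - r / 4] because [mirror_gap] leaves a gap of [s - r / 8], of which [r / 8] is kept. *)
Lemma aligned_target (r d eta : R) (p q0 q : R * R) :
  0 < r -> 0 < d <= r -> 0 <= eta <= r / 1000 ->
  in_unit_square p -> in_unit_square q ->
  dist2 q0 q <= r ^ 2 -> r ^ 2 < dist2 p q -> aligned r eta p q0 ->
  exists z, in_unit_square z /\ dist2 p z <= (r - d) ^ 2 /\
    forall p', in_unit_square p' -> dist2 z p' <= d ^ 2 ->
      aligned r (eta + 2 * d) p' q /\
      snd p + sqrt (r ^ 2 - (fst q - fst q0) ^ 2) - r / 4 - 2 * d <= snd p'.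
Proof.
  destruct p as [a b], q0 as [x0 y0], q as [x y].
  unfold in_unit_square, aligned, dist2 at 1 2; simpl fst; simpl snd.
  intros Hr Hd Heta [Ha Hb] [Hx Hy] Hstep Hfar [Hlag Hinv].
  pose proof (pow2_ge_0 (x - x0)) as Qx. pose proof (pow2_ge_0 (y - y0)) as Qy.
  assert (Hstep' : (x - x0) ^ 2 + (y - y0) ^ 2 <= r ^ 2) by lra.
  set (s := sqrt (r ^ 2 - (x - x0) ^ 2)).
  assert (Hs0 : 0 <= s) by apply sqrt_pos.
  assert (Es : s ^ 2 = r ^ 2 - (x - x0) ^ 2) by (unfold s; rewrite pow2_sqrt; lra).
  assert (Hgap : s - r / 8 <= y - b).
  { pose proof (mirror_gap r eta b y0 (x - x0) (y - y0) (x0 - a) s Hr Heta Hs0 Es) as M.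
    replace (y - b) with (y0 + (y - y0) - b) by ring. apply M; lra. }
  assert (Hdx : - r <= x - x0 <= r) by (apply sq_le_abs; lra).
  assert (Hsr : s <= r) by nra.
  assert (Hdy : - s <= y - y0 <= s) by (apply sq_le_abs; lra).
  (* Scaling by [theta] turns moves of length [r] into moves of length [r - d], leaving room for the
     rounding. *)
  set (theta := 1 - d / r).
  assert (Hth : theta * r = r - d) by (unfold theta; field; lra).
  assert (Hth01 : 0 <= theta <= 1).
  { split; [nra|]. unfold theta. assert (0 < d / r) by (apply Rdiv_lt_0_compat; lra). lra. }
  (* Ideal climb: restore the distance r/8 to the robber as well as possible. *)
  set (g := Rmax (- s) (Rmin s (y - b - r / 8))).
  assert (Hg : - s <= g <= s) by (unfold g, Rmax, Rmin; repeat destruct Rle_dec; lra).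
  assert (Hglow : s - r / 4 <= g) by (unfold g, Rmax, Rmin; repeat destruct Rle_dec; lra).
  assert (Hgcase : g <= y - b - r / 8 \/ (g = - s /\ y - b - r / 8 < - s))
    by (unfold g, Rmax, Rmin; repeat destruct Rle_dec; lra).
  clearbody g.
  set (h := Rmax 0 (b + theta * g)).
  (* As [a] and [x] lie in [[0,1]], clamping neither lengthens the move nor increases the distance
     to [x]. *)
  set (u := Rmax 0 (Rmin 1 (a + theta * (x - x0)))).
  pose proof (scale_le theta (x - x0) r d Hth01 Hth Hdx) as Sx.
  pose proof (scale_le theta g r d Hth01 Hth ltac:(lra)) as Sg.
  assert (Hu01 : 0 <= u <= 1) by (unfold u, Rmax, Rmin; repeat destruct Rle_dec; lra).
  assert (Hux : - (eta + d) <= x - u <= eta + d)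
    by (unfold u, Rmax, Rmin; repeat destruct Rle_dec; lra).
  assert (Huv : (u - a) ^ 2 <= (theta * (x - x0)) ^ 2).
  { apply sq_between. unfold u, Rmax, Rmin; repeat destruct Rle_dec; lra. }
  assert (Hh1 : h <= 1).
  { unfold h, Rmax; destruct Rle_dec; [|lra].
    pose proof (Rmult_le_pos theta s (proj1 Hth01) Hs0).
    destruct Hgcase as [|[-> _]]; [|lra].
    destruct (Rle_dec 0 g) as [Hg0|Hg0].
    - pose proof (Rmult_le_compat_r g theta 1 Hg0 (proj2 Hth01)). lra.
    - pose proof (Rmult_le_compat_l theta g 0 (proj1 Hth01) ltac:(lra)). lra. }
  assert (Hhb : (h - b) ^ 2 <= (theta * s) ^ 2).
  { apply Rle_trans with ((theta * g) ^ 2); [|apply abs_scale_sq; lra].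
    apply sq_between. unfold h, Rmax; destruct Rle_dec; lra. }
  assert (Hh : b + theta * g <= h) by apply Rmax_r.
  assert (Hhcase : h = 0 \/ h = b + theta * g)
    by (unfold h, Rmax; destruct Rle_dec; lra).
  assert (Hh0 : 0 <= h) by apply Rmax_l.
  clearbody h u theta s.
  exists (u, h); cbn [fst snd]. split; [lra|split].
  - unfold dist2; simpl fst; simpl snd. rewrite <- Hth.
    replace ((theta * r) ^ 2) with ((theta * (x - x0)) ^ 2 + (theta * s) ^ 2)
      by (rewrite !Rpow_mult_distr, Es; ring).
    lra.
  - intros [a' b'] [Ha' Hb'] Hz. simpl in Ha', Hb' |- *.
    apply dist2_coords in Hz; [|lra]. simpl in Hz.
    split; [split; [lra|]|].
    + destruct Hhcase as [->| Eh]; [right; lra|].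
      destruct Hgcase as [Hgz|[Eg Hlt]]; [left; lra|].
      (* Even the full descent [- s] does not restore the gap [r / 8]. But the robber dropped by at
         most [s] too, so an old gap survives; and a cop near the bottom edge stays there. *)
      destruct Hinv as [HD|Hbe]; [left|right].
      * lra.
      * pose proof (Rmult_le_pos theta s (proj1 Hth01) Hs0).
        assert (theta * g = - (theta * s)) by (rewrite Eg; ring). lra.
    + lra.
Qed.

(** If the robber's new abscissa is at most [r] ahead, the cop moves level with it; otherwise he
    walks [r - d] to the right, which cannot overshoot even after rounding. The abscissa cannot be
    more than [r] behind, since the cop was not to the right of the robber's previous position. *)
Lemma chase_target (r d : R) (p q0 q : R * R) :
  0 < r -> 0 < d <= r / 8 ->
  in_unit_square p -> in_unit_square q ->
  dist2 q0 q <= r ^ 2 -> fst p <= fst q0 ->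
  exists z, in_unit_square z /\ dist2 p z <= (r - d) ^ 2 /\
    forall p', dist2 z p' <= d ^ 2 ->
      snd p' <= snd p + d /\
      (- (2 * d) <= fst q - fst p' <= 2 * d \/
       (fst p' <= fst q /\ fst p + r / 2 <= fst p')).
Proof.
  destruct p as [a b], q0 as [x0 y0], q as [x y].
  unfold in_unit_square, dist2 at 1; simpl fst; simpl snd.
  intros Hr Hd [Ha Hb] [Hx Hy] Hstep Hle.
  pose proof (pow2_ge_0 (y0 - y)).
  assert (Hdx : - r <= x0 - x <= r) by (apply sq_le_abs; lra).
  destruct (Rle_dec (x - a) r) as [Hnear|Hfar].
  - set (theta := 1 - d / r).
    assert (Hth : theta * r = r - d) by (unfold theta; field; lra).
    assert (Hth01 : 0 <= theta <= 1).
    { split; [nra|]. unfold theta. assert (0 < d / r) by (apply Rdiv_lt_0_compat; lra). lra. }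
    clearbody theta.
    pose proof (scale_le theta (x - a) r d Hth01 Hth ltac:(lra)) as Sx.
    exists (a + theta * (x - a), b). cbn [fst snd]. split; [split; [nra|lra]|split].
    + unfold dist2; simpl fst; simpl snd. rewrite <- Hth.
      pose proof (abs_scale_sq theta r (x - a) ltac:(lra) ltac:(lra)). nra.
    + intros [a' b'] Hz. apply dist2_coords in Hz; [|lra]. simpl in Hz |- *. lra.
  - exists (a + (r - d), b). cbn [fst snd]. split; [lra|split].
    + unfold dist2; simpl. nra.
    + intros [a' b'] Hz. apply dist2_coords in Hz; [|lra]. simpl in Hz |- *. lra.
Qed.

(** Error accumulated after [t] rounds: [2 * d] per round, plus an allowance for the initial
    placement near the corner. *)
Definition drift (d : R) (t : nat) : R := 2 * d * (INR t + 1).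

(* The second alternative is the initial walk along the bottom edge. *)
Definition tracking (r d : R) (t : nat) (p q : R * R) : Prop :=
  aligned r (drift d t) p q \/
  (fst p <= fst q /\ INR t * (r / 2) <= fst p /\ snd p <= drift d t).

(** The climb is promised only to a cop already aligned; during the initial walk there is no height
    gain to record. *)
Definition good_move (r d : R) (t : nat) (p q0 q p' : R * R) : Prop :=
  tracking r d (S t) p' q /\
  (aligned r (drift d t) p q0 ->
   aligned r (drift d (S t)) p' q /\
   snd p + sqrt (r ^ 2 - (fst q - fst q0) ^ 2) - r / 4 - 2 * d <= snd p').

Definition net (n : nat) (f : nat -> R * R) (d : R) : Prop :=
  forall z, in_unit_square z -> exists v, (v < n)%nat /\ dist2 z (f v) <= d ^ 2.

Lemma drift_S (d : R) (t : nat) : drift d (S t) = drift d t + 2 * d.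
Proof. unfold drift. rewrite S_INR. ring. Qed.

Lemma drift_ge (d : R) (t : nat) : 0 < d -> 2 * d <= drift d t.
Proof. intros Hd. unfold drift. pose proof (pos_INR t). nra. Qed.

(** The target is within [r - d] of the cop and some vertex of the net within [d] of the target, so
    that vertex is within [r] of the cop. The error increase matches one step of [drift]. *)
Lemma good_move_exists (n : nat) (f : nat -> R * R) (r d : R) (t u w0 w : nat) :
  0 < r -> 0 < d <= r / 8 -> drift d t <= r / 1000 ->
  (forall v, (v < n)%nat -> in_unit_square (f v)) -> net n f d ->
  (u < n)%nat -> (w < n)%nat ->
  dist2 (f w0) (f w) <= r ^ 2 -> r ^ 2 < dist2 (f u) (f w) ->
  tracking r d t (f u) (f w0) ->
  exists v, (v < n)%nat /\ dist2 (f u) (f v) <= r ^ 2 /\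
    good_move r d t (f u) (f w0) (f w) (f v).
Proof.
  intros Hr Hd Hdrift Hsq Hnet Hu Hw Hstep Hfar Htrack.
  pose proof (drift_ge d t ltac:(lra)) as Hge.
  destruct (classic (aligned r (drift d t) (f u) (f w0))) as [Hal|Hal].
  - destruct (aligned_target r d (drift d t) (f u) (f w0) (f w))
      as (z & Hz & Hpz & Hp'); auto; try lra.
    destruct (Hnet z Hz) as (v & Hv & Hzv).
    exists v. destruct (Hp' (f v) (Hsq v Hv) Hzv) as [Hal' Hgain].
    rewrite <- drift_S in Hal'.
    split; [assumption|split].
    + replace r with ((r - d) + d) by ring.
      apply dist2_triangle with z; try assumption; lra.
    + split; [left; assumption|]. intros _. split; assumption.
  - destruct Htrack as [H|(Hle & Hprog & Hlow)]; [contradiction|].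
    destruct (chase_target r d (f u) (f w0) (f w))
      as (z & Hz & Hpz & Hp'); auto.
    destruct (Hnet z Hz) as (v & Hv & Hzv).
    exists v. destruct (Hp' (f v) Hzv) as [Hlow' Hcase].
    split; [assumption|split].
    + replace r with ((r - d) + d) by ring.
      apply dist2_triangle with z; try assumption; lra.
    + split; [|intros; contradiction].
      unfold tracking, aligned. rewrite drift_S, S_INR.
      destruct Hcase as [Hc|[Hc1 Hc2]].
      * left. split; [lra|right; lra].
      * right. repeat split; lra.
Qed.

(** * The pursuit strategy *)

(* Cop 0 stays below the robber, cop 1 stays to his left; exchanging the
   coordinates turns the second task into the first. *)
Definition frame (i : nat) (p : R * R) : R * R :=
  match i with O => p | S _ => (snd p, fst p) end.

Lemma frame_dist2 (i : nat) (p q : R * R) :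
  dist2 (frame i p) (frame i q) = dist2 p q.
Proof. destruct i; unfold dist2; simpl; ring. Qed.

Lemma frame_in_unit_square (i : nat) (p : R * R) :
  in_unit_square p -> in_unit_square (frame i p).
Proof. destruct i; unfold in_unit_square; simpl; tauto. Qed.

Lemma frame_net (n : nat) (f : nat -> R * R) (d : R) (i : nat) :
  net n f d -> net n (fun v => frame i (f v)) d.
Proof.
  intros Hnet z Hz.
  destruct (Hnet (frame i z) (frame_in_unit_square i z Hz)) as (v & Hv & Hd).
  exists v. split; [assumption|].
  replace z with (frame i (frame i z)) by (destruct i, z; reflexivity).
  rewrite frame_dist2. assumption.
Qed.

Definition robber_now (h : list state) : nat := snd (hd dummy_state h).
(* Before the robber's first move this is his current position. *)
Definition robber_before (h : list state) : nat :=
  snd (hd (hd dummy_state h) (tl h)).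
Definition cop_now (h : list state) (i : nat) : nat := fst (hd dummy_state h) i.

(** The history starts with the initial placement, so [length (tl h)] is the number of rounds
    played. *)
Definition wanted (n : nat) (x : nat -> R * R) (r d : R)
    (h : list state) (i v : nat) : Prop :=
  step_ok (rgg_adj n x r) (cop_now h i) v /\
  good_move r d (length (tl h)) (frame i (x (cop_now h i)))
    (frame i (x (robber_before h))) (frame i (x (robber_now h))) (frame i (x v)).

(** Capture comes first, then a wanted vertex picked by choice; staying put as the fallback keeps
    the strategy legal on every history. *)
Definition pursuit_next (n : nat) (x : nat -> R * R) (r d : R)
    (h : list state) (i : nat) : nat :=
  if excluded_middle_informative
       (step_ok (rgg_adj n x r) (cop_now h i) (robber_now h))
  then robber_now h
  else match excluded_middle_informative (exists v, wanted n x r d h i v) with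
       | left H => proj1_sig (constructive_indefinite_description _ H)
       | right _ => cop_now h i
       end.

Definition pursuit (n : nat) (x : nat -> R * R) (r d : R) (v0 : nat) : cop_strategy :=
  CopStrat (fun _ => v0) (pursuit_next n x r d).

Lemma pursuit_legal (n : nat) (x : nat -> R * R) (r d : R) (v0 k : nat) :
  (v0 < n)%nat -> cop_legal n k (rgg_adj n x r) (pursuit n x r d v0).
Proof.
  intros Hv0. split; [intros; exact Hv0|].
  intros h i _. simpl. unfold pursuit_next.
  destruct excluded_middle_informative as [H|_]; [exact H|].
  destruct excluded_middle_informative as [H|_]; [|left; reflexivity].
  destruct constructive_indefinite_description as [v Hv]. exact (proj1 Hv).
Qed.

Lemma pursuit_next_wanted (n : nat) (x : nat -> R * R) (r d : R) (h : list state) (i : nat) :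
  ~ step_ok (rgg_adj n x r) (cop_now h i) (robber_now h) ->
  (exists v, wanted n x r d h i v) ->
  wanted n x r d h i (pursuit_next n x r d h i).
Proof.
  intros Hfar Hex. unfold pursuit_next.
  destruct excluded_middle_informative as [H|_]; [contradiction|].
  destruct excluded_middle_informative as [H|H]; [|contradiction].
  destruct constructive_indefinite_description as [v Hv]. exact Hv.
Qed.

Lemma step_ok_dist2 (n : nat) (x : nat -> R * R) (r : R) (u v : nat) :
  0 <= r -> (u < n)%nat -> (v < n)%nat ->
  (step_ok (rgg_adj n x r) u v <-> dist2 (x u) (x v) <= r ^ 2).
Proof.
  intros Hr Hu Hv. rewrite <- euclid_le_iff by assumption. split.
  - intros [->|(_ & _ & _ & H)]; [|assumption].
    apply euclid_le_iff; [assumption|]. unfold dist2.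
    pose proof (pow2_ge_0 r). nra.
  - intros H. destruct (Nat.eq_dec v u) as [E|E]; [left; assumption|right].
    repeat split; auto.
Qed.

Lemma step_ok_lt (n : nat) (x : nat -> R * R) (r : R) (u v : nat) :
  (u < n)%nat -> step_ok (rgg_adj n x r) u v -> (v < n)%nat.
Proof. intros Hu [->|(_ & H & _)]; assumption. Qed.

(** The radicands add up to at least [r ^ 2], and squaring the sum of the roots only adds a
    nonnegative cross term. *)
Lemma sqrt_legs_sum (r dx dy : R) :
  0 <= r -> dx ^ 2 + dy ^ 2 <= r ^ 2 ->
  r <= sqrt (r ^ 2 - dx ^ 2) + sqrt (r ^ 2 - dy ^ 2).
Proof.
  intros Hr H.
  pose proof (pow2_ge_0 dx). pose proof (pow2_ge_0 dy).
  pose proof (sqrt_pos (r ^ 2 - dx ^ 2)) as P1.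
  pose proof (sqrt_pos (r ^ 2 - dy ^ 2)) as P2.
  pose proof (pow2_sqrt (r ^ 2 - dx ^ 2) ltac:(lra)) as E1.
  pose proof (pow2_sqrt (r ^ 2 - dy ^ 2) ltac:(lra)) as E2.
  nra.
Qed.

Lemma nat_ceiling (v : R) : 0 <= v -> exists k : nat, v < INR k <= v + 1.
Proof.
  intros Hv. destruct (archimed v) as [H1 H2].
  exists (Z.to_nat (up v)).
  rewrite INR_IZR_INZ, Z2Nat.id; [lra|].
  apply le_IZR. lra.
Qed.

(** * Refuting a robber who is never caught *)

Section Pursuit.

Variables (n : nat) (x : nat -> R * R) (r d : R) (v0 : nat) (rs : robber_strategy).

Hypothesis Hr : 0 < r.
Hypothesis Hd : 0 < d.
Hypothesis Hdr : d <= r ^ 2 / 50000.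
Hypothesis Hsq : forall v, (v < n)%nat -> in_unit_square (x v).
Hypothesis Hnet : net n x d.
Hypothesis Hv0 : (v0 < n)%nat.
Hypothesis Horigin : dist2 (0, 0) (x v0) <= d ^ 2.
Hypothesis Hrs : robber_legal n (rgg_adj n x r) rs.

Let cs := pursuit n x r d v0.

Hypothesis Hfree : ~ captured 2 cs rs.

Let hist (t : nat) : list state := play cs rs t.

Lemma robber_before_S (t : nat) : robber_before (hist (S t)) = robber_now (hist t).
Proof. destruct t; reflexivity. Qed.

Lemma length_tl_hist (t : nat) : length (tl (hist t)) = t.
Proof.
  induction t as [|t IH]; [reflexivity|].
  change (length (hist t) = S t). rewrite <- IH at 2. destruct t; reflexivity.
Qed.

Lemma robber_now_lt (t : nat) : (robber_now (hist t) < n)%nat.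
Proof.
  destruct Hrs as [Hi Hs]. induction t as [|t IH]; [apply Hi|].
  apply (step_ok_lt n x r _ _ IH). apply Hs.
Qed.

Lemma cop_now_lt (t i : nat) : (i < 2)%nat -> (cop_now (hist t) i < n)%nat.
Proof.
  intros Hi. destruct (pursuit_legal n x r d v0 2 Hv0) as [H0 Hs].
  induction t as [|t IH]; [apply H0; assumption|].
  apply (step_ok_lt n x r _ _ IH). apply (Hs (hist t) i Hi).
Qed.

Lemma robber_step (t : nat) :
  (robber_before (hist t) < n)%nat /\
  dist2 (x (robber_before (hist t))) (x (robber_now (hist t))) <= r ^ 2.
Proof.
  destruct t as [|t].
  - change (robber_before (hist 0)) with (robber_now (hist 0)).
    split; [apply robber_now_lt|]. unfold dist2. pose proof (pow2_ge_0 r). nra.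
  - rewrite robber_before_S. split; [apply robber_now_lt|].
    apply (step_ok_dist2 n); [lra|apply robber_now_lt|apply robber_now_lt|].
    apply (proj2 Hrs).
Qed.

(** A cop who could step onto the robber would do so, which is a capture. *)
Lemma not_reached (t i : nat) : (i < 2)%nat ->
  ~ step_ok (rgg_adj n x r) (cop_now (hist t) i) (robber_now (hist t)).
Proof.
  intros Hi H. apply Hfree. exists t, i. split; [assumption|]. right.
  change (pursuit_next n x r d (hist t) i = robber_now (hist t)).
  unfold pursuit_next. destruct excluded_middle_informative; [reflexivity|contradiction].
Qed.

Lemma robber_far (t i : nat) : (i < 2)%nat ->
  r ^ 2 < dist2 (x (cop_now (hist t) i)) (x (robber_now (hist t))).
Proof.
  intros Hi. apply Rnot_le_lt. intros H. apply (not_reached t i Hi).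
  apply step_ok_dist2; auto using cop_now_lt, robber_now_lt. lra.
Qed.

(** The robber is out of reach inside the unit square. This bound makes [d], of order [r ^ 2], small
    compared with [r]. *)
Lemma r_lt_2 : r < 2.
Proof.
  pose proof (robber_far 0 0 ltac:(lia)) as H.
  destruct (Hsq _ (cop_now_lt 0 0 ltac:(lia))) as [Ha Hb].
  destruct (Hsq _ (robber_now_lt 0)) as [Ha' Hb'].
  unfold dist2 in H. nra.
Qed.

Let cop (t i : nat) : R * R := frame i (x (cop_now (hist t) i)).

(** The cop is compared with the robber's position before his latest move, the one the cop was
    answering. *)
Definition tracked (t : nat) : Prop := forall i, (i < 2)%nat ->
  tracking r d t (cop t i) (frame i (x (robber_before (hist t)))).

Lemma d_small : d <= r / 16.
Proof. pose proof r_lt_2. assert (r ^ 2 <= 2 * r) by nra. lra. Qed.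

Lemma pursuit_good_move (t i : nat) :
  (i < 2)%nat -> drift d t <= r / 1000 -> tracked t ->
  good_move r d t (cop t i) (frame i (x (robber_before (hist t))))
    (frame i (x (robber_now (hist t)))) (cop (S t) i).
Proof.
  intros Hi Hdrift Htr.
  destruct (good_move_exists n (fun v => frame i (x v)) r d t (cop_now (hist t) i)
              (robber_before (hist t)) (robber_now (hist t)))
    as (v & Hv & Hstep & Hgood).
  all: rewrite ?frame_dist2 in *; auto using cop_now_lt, robber_now_lt,
         frame_in_unit_square, frame_net, robber_far.
  - pose proof d_small. lra.
  - apply robber_step.
  - apply Htr, Hi.
  - assert (Hw : wanted n x r d (hist t) i (pursuit_next n x r d (hist t) i)).
    { apply pursuit_next_wanted; [apply not_reached, Hi|].
      exists v. split.
      - apply step_ok_dist2; auto using cop_now_lt. lra.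
      - rewrite length_tl_hist. exact Hgood. }
    destruct Hw as [_ Hw]. rewrite length_tl_hist in Hw. exact Hw.
Qed.

(** Both cops start within [d] of the corner. A robber with smaller abscissa is then already aligned
    up to [d]; any other one is being walked towards. *)
Lemma tracked_0 : tracked 0.
Proof.
  intros i Hi. unfold cop. change (cop_now (hist 0) i) with v0.
  change (robber_before (hist 0)) with (robber_now (hist 0)).
  pose proof (frame_in_unit_square i _ (Hsq _ (robber_now_lt 0))) as [Hq _].
  pose proof (frame_in_unit_square i _ (Hsq _ Hv0)) as [Hp _].
  rewrite <- (frame_dist2 i) in Horigin.
  apply dist2_coords in Horigin; [|lra].
  replace (frame i (0, 0)) with (0, 0) in Horigin by (destruct i; reflexivity).
  simpl fst in *; simpl snd in *. unfold tracking, aligned, drift. simpl INR.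
  destruct (Rle_dec (fst (frame i (x v0))) (fst (frame i (x (robber_now (hist 0))))));
    [right; repeat split; lra|left; split; [lra|right; lra]].
Qed.

Lemma tracked_le (T t : nat) : drift d T <= r / 1000 -> (t <= T)%nat -> tracked t.
Proof.
  intros HT. induction t as [|t IH]; intros Ht; [apply tracked_0|].
  intros i Hi. rewrite robber_before_S.
  apply (pursuit_good_move t i Hi); [|apply IH; lia].
  unfold drift in *. pose proof (le_INR t T ltac:(lia)). nra.
Qed.

Lemma pursuit_contradiction : False.
Proof.
  pose proof r_lt_2 as Hr2. pose proof d_small as Hds.
  (* The walk gains [r / 2] per round, so it would leave the square by round [T1]. *)
  destruct (nat_ceiling (2 / r)) as (T1 & HT1l & HT1u).
  { apply Rlt_le, Rdiv_lt_0_compat; lra. }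
  assert (H1 : 2 < INR T1 * r).
  { replace 2 with (2 / r * r) by (field; lra). nra. }
  assert (H2 : INR T1 * r <= 4).
  { assert (INR T1 * r <= (2 / r + 1) * r) by nra.
    replace ((2 / r + 1) * r) with (2 + r) in * by (field; lra). lra. }
  (* [T1] rounds of walking, then [4 * T1] rounds of climbing. *)
  set (T := (5 * T1)%nat).
  assert (ET : INR T = 5 * INR T1) by (unfold T; rewrite mult_INR; simpl; ring).
  (* As [INR T1 * r <= 4] and [r < 2], the drift times [r] is at most [44 * d]; this fixes the
     constant 50000. *)
  assert (HT : drift d T <= r / 1000).
  { unfold drift. apply Rmult_le_reg_r with r; [lra|].
    replace (2 * d * (INR T + 1) * r) with (2 * d * (5 * (INR T1 * r) + r))
      by (rewrite ET; ring).
    nra. }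
  assert (Hcop : forall t i, (i < 2)%nat -> in_unit_square (cop t i)).
  { intros t i Hi. apply frame_in_unit_square, Hsq, cop_now_lt, Hi. }
  assert (Hal : forall t i, (T1 <= t <= T)%nat -> (i < 2)%nat ->
            aligned r (drift d t) (cop t i) (frame i (x (robber_before (hist t))))).
  { intros t i Ht Hi.
    destruct (tracked_le T t HT ltac:(lia) i Hi) as [H|(_ & H & _)]; [exact H|].
    destruct (Hcop t i Hi) as [Hc _]. pose proof (le_INR T1 t ltac:(lia)). nra. }
  (* Each round gains at least [r - 2 * (r / 4) - 4 * d >= r / 4]. After [4 * T1] rounds the sum
     exceeds 2, which is impossible in the unit square. *)
  assert (Hsum : forall k, (T1 + k <= T)%nat ->
            INR k * (r / 4) <= snd (cop (T1 + k) 0) + snd (cop (T1 + k) 1)).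
  { induction k as [|k IH]; intros Hk.
    - simpl INR. destruct (Hcop (T1 + 0)%nat 0%nat ltac:(lia)) as [_ Ha].
      destruct (Hcop (T1 + 0)%nat 1%nat ltac:(lia)) as [_ Hb]. lra.
    - specialize (IH ltac:(lia)).
      replace (T1 + S k)%nat with (S (T1 + k)) by lia.
      set (t := (T1 + k)%nat) in *.
      assert (Htr : tracked t) by (apply (tracked_le T); [assumption|lia]).
      assert (Hdt : drift d t <= r / 1000).
      { unfold drift in *. pose proof (le_INR t T ltac:(lia)). nra. }
      destruct (pursuit_good_move t 0 ltac:(lia) Hdt Htr) as [_ G0].
      destruct (pursuit_good_move t 1 ltac:(lia) Hdt Htr) as [_ G1].
      destruct (G0 (Hal t 0%nat ltac:(lia) ltac:(lia))) as [_ G0'].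
      destruct (G1 (Hal t 1%nat ltac:(lia) ltac:(lia))) as [_ G1'].
      destruct (robber_step t) as [_ Hst].
      revert G0' G1' Hst. unfold dist2. cbn [frame fst snd].
      set (p := x (robber_before (hist t))). set (q := x (robber_now (hist t))).
      intros G0' G1' Hst.
      pose proof (sqrt_legs_sum r (fst q - fst p) (snd q - snd p) ltac:(lra) ltac:(lra)).
      rewrite S_INR. lra. }
  specialize (Hsum (4 * T1)%nat ltac:(lia)).
  destruct (Hcop (T1 + 4 * T1)%nat 0%nat ltac:(lia)) as [_ Ha].
  destruct (Hcop (T1 + 4 * T1)%nat 1%nat ltac:(lia)) as [_ Hb].
  rewrite mult_INR in Hsum. simpl (INR 4) in Hsum. lra.
Qed.

End Pursuit.

Lemma two_cops_win (n : nat) (x : nat -> R * R) (r d : R) :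
  0 < r -> 0 < d -> d <= r ^ 2 / 50000 -> in_unit_square_n n x -> net n x d ->
  cop_number_le n (rgg_adj n x r) 2.
Proof.
  intros Hr Hd Hdr Hsq Hnet.
  destruct (Hnet (0, 0)) as (v0 & Hv0 & Horigin).
  { unfold in_unit_square; simpl; lra. }
  exists 2%nat. split; [lia|].
  exists (pursuit n x r d v0). split; [apply pursuit_legal, Hv0|].
  intros rs Hrs. apply NNPP. intros Hfree.
  exact (pursuit_contradiction n x r d v0 rs Hr Hd Hdr Hsq Hnet Hv0 Horigin Hrs Hfree).
Qed.

(** * Covering the bad event by boxes *)

Definition total {T : Type} (f : T -> R) (l : list T) : R :=
  fold_right (fun a s => f a + s) 0 l.

Lemma total_app {T : Type} (f : T -> R) (l1 l2 : list T) :
  total f (l1 ++ l2) = total f l1 + total f l2.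
Proof. induction l1 as [|a l1 IH]; simpl; [|rewrite IH]; ring. Qed.

Lemma total_ge0 {T : Type} (f : T -> R) (l : list T) :
  (forall a, In a l -> 0 <= f a) -> 0 <= total f l.
Proof.
  induction l as [|a l IH]; simpl; intros H; [lra|].
  pose proof (H a (or_introl eq_refl)). specialize (IH (fun b Hb => H b (or_intror Hb))). lra.
Qed.

Definition rect : Type := ((R * R) * (R * R))%type.

Definition in_rect (c : rect) (p : R * R) : Prop :=
  fst (fst c) <= fst p <= fst (snd c) /\ snd (fst c) <= snd p <= snd (snd c).

Definition rect_ok (c : rect) : Prop :=
  fst (fst c) <= fst (snd c) /\ snd (fst c) <= snd (snd c).

Definition area (c : rect) : R :=
  (fst (snd c) - fst (fst c)) * (snd (snd c) - snd (fst c)).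

Definition extend_box (n : nat) (B : box) (c : rect) : box :=
  Box (fun i => if Nat.eqb i n then fst c else lo B i)
      (fun i => if Nat.eqb i n then snd c else hi B i).

Lemma prodR_ext (n : nat) (f g : nat -> R) :
  (forall i, (i < n)%nat -> f i = g i) -> prodR n f = prodR n g.
Proof.
  induction n as [|n IH]; simpl; intros H; [reflexivity|].
  rewrite (H n), IH; auto.
Qed.

Lemma extend_box_vol (n : nat) (B : box) (c : rect) :
  box_vol (S n) (extend_box n B c) = box_vol n B * area c.
Proof.
  unfold box_vol. simpl. rewrite Nat.eqb_refl. f_equal.
  apply prodR_ext. intros i Hi.
  destruct (Nat.eqb_spec i n); [lia|reflexivity].
Qed.

Lemma extend_box_ok (n : nat) (B : box) (c : rect) :
  box_ok n B -> rect_ok c -> box_ok (S n) (extend_box n B c).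
Proof.
  intros HB Hc i Hi. simpl.
  destruct (Nat.eqb_spec i n); [exact Hc|apply HB; lia].
Qed.

Lemma extend_box_in (n : nat) (B : box) (c : rect) (x : nat -> R * R) :
  in_box n B x -> in_rect c (x n) -> in_box (S n) (extend_box n B c) x.
Proof.
  intros HB Hc i Hi. simpl.
  destruct (Nat.eqb_spec i n) as [->|]; [exact Hc|apply HB; lia].
Qed.

(** Finite covers suffice here, and recording their exact volume lets products and unions be
    computed. *)
Definition coverable (n : nat) (E : (nat -> R * R) -> Prop) (v : R) : Prop :=
  exists Bs : list box,
    (forall B, In B Bs -> box_ok n B) /\ total (box_vol n) Bs = v /\
    forall x, E x -> exists B, In B Bs /\ in_box n B x.

(** Take one box for each choice of a rectangle per point; by distributivity the volumes sum to the
    power. *)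
Lemma coverable_pow (n : nat) (l : list rect) :
  (forall c, In c l -> rect_ok c) ->
  coverable n (fun x => forall i, (i < n)%nat -> exists c, In c l /\ in_rect c (x i))
    (total area l ^ n).
Proof.
  intros Hl. induction n as [|n (Bs & Hok & Hvol & Hcov)].
  - exists (Box (fun _ => (0, 0)) (fun _ => (0, 0)) :: nil). split; [|split].
    + intros B _ i Hi. lia.
    + simpl. unfold box_vol. simpl. ring.
    + intros x _. eexists. split; [left; reflexivity|]. intros i Hi. lia.
  - exists (flat_map (fun B => map (extend_box n B) l) Bs). split; [|split].
    + intros B HB. apply in_flat_map in HB. destruct HB as (B0 & HB0 & HB).
      apply in_map_iff in HB. destruct HB as (c & <- & Hc).
      apply extend_box_ok; auto.
    + simpl. rewrite <- Hvol. clear.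
      induction Bs as [|B Bs IH]; simpl; [ring|].
      rewrite total_app, IH.
      replace (total (box_vol (S n)) (map (extend_box n B) l))
        with (total area l * box_vol n B); [ring|].
      clear. induction l as [|c l IH]; simpl; [ring|].
      rewrite extend_box_vol, <- IH. ring.
    + intros x Hx. destruct (Hcov x) as (B & HB & HxB); [auto|].
      destruct (Hx n) as (c & Hc & Hxc); [lia|].
      exists (extend_box n B c). split; [|apply extend_box_in; assumption].
      apply in_flat_map. exists B. split; [assumption|apply in_map; assumption].
Qed.

Lemma coverable_union (n m : nat) (E : nat -> (nat -> R * R) -> Prop) (v : R) :
  (forall j, (j < m)%nat -> coverable n (E j) v) ->
  coverable n (fun x => exists j, (j < m)%nat /\ E j x) (INR m * v).
Proof.
  induction m as [|m IH]; intros H.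
  - exists nil. simpl. split; [tauto|split; [ring|]].
    intros x (j & Hj & _). lia.
  - destruct IH as (Bs & Hok & Hvol & Hcov); [auto|].
    destruct (H m) as (Bs' & Hok' & Hvol' & Hcov'); [lia|].
    exists (Bs ++ Bs'). split; [|split].
    + intros B HB. apply in_app_iff in HB. destruct HB; auto.
    + rewrite total_app, Hvol, Hvol', S_INR. ring.
    + intros x (j & Hj & Hx). destruct (Nat.eq_dec j m) as [->|Hne].
      * destruct (Hcov' x Hx) as (B & HB & HxB).
        exists B. rewrite in_app_iff. auto.
      * destruct (Hcov x) as (B & HB & HxB).
        { exists j. split; [lia|assumption]. }
        exists B. rewrite in_app_iff. auto.
Qed.

Lemma sumR_S (m : nat) (f : nat -> R) :
  sumR (S m) f = f O + sumR m (fun j => f (S j)).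
Proof.
  induction m as [|m IH]; [simpl; ring|].
  change (sumR (S (S m)) f) with (sumR (S m) f + f (S m)).
  rewrite IH. simpl. ring.
Qed.

Lemma sumR_nth_le {T : Type} (g : T -> R) (l : list T) (a0 : T) (m : nat) :
  (forall a, In a l -> 0 <= g a) -> g a0 = 0 ->
  sumR m (fun j => g (nth j l a0)) <= total g l.
Proof.
  intros Hpos H0. revert m. induction l as [|a l IH]; intros m.
  - simpl. induction m as [|m IHm]; simpl; [lra|].
    destruct m; rewrite H0; lra.
  - simpl total. destruct m as [|m].
    + pose proof (total_ge0 g (a :: l) Hpos). simpl in *. lra.
    + rewrite sumR_S. simpl.
      specialize (IH (fun b Hb => Hpos b (or_intror Hb)) m). lra.
Qed.

Lemma prodR_ge0 (n : nat) (f : nat -> R) :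
  (forall i, (i < n)%nat -> 0 <= f i) -> 0 <= prodR n f.
Proof.
  induction n as [|n IH]; simpl; intros H; [lra|].
  apply Rmult_le_pos; auto.
Qed.

Lemma box_vol_ge0 (n : nat) (B : box) : box_ok n B -> 0 <= box_vol n B.
Proof.
  intros HB. apply prodR_ge0. intros i Hi. destruct (HB i Hi).
  apply Rmult_le_pos; lra.
Qed.

Lemma coverable_outer_measure_lt (n : nat) (E : (nat -> R * R) -> Prop) (v eps : R) :
  (0 < n)%nat -> coverable n E v -> v < eps -> outer_measure_lt n E eps.
Proof.
  intros Hn (Bs & Hok & Hvol & Hcov) Hv.
  (* A degenerate box pads the list to a sequence. Its volume is 0 because [n > 0]; for [n = 0] the
     empty product would be 1. *)
  set (B0 := Box (fun _ => (0, 0)) (fun _ => (0, 0))).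
  exists (fun j => nth j Bs B0), v. split; [|split; [|split]].
  - intros j. destruct (nth_in_or_default j Bs B0) as [H| ->]; [auto|].
    intros i _. simpl. lra.
  - intros m. rewrite <- Hvol. apply sumR_nth_le.
    + intros B HB. apply box_vol_ge0; auto.
    + destruct n as [|n]; [lia|]. unfold box_vol. simpl. ring.
  - assumption.
  - intros x Hx. destruct (Hcov x Hx) as (B & HB & HxB).
    destruct (In_nth Bs B B0 HB) as (j & _ & <-). exists j. assumption.
Qed.

(** * Grid cells: emptiness and the net property *)

Definition cell (h : R) (i j : nat) : rect :=
  ((INR i * h, INR j * h), (INR i * h + h, INR j * h + h)).

(** Every point avoiding the cell lies in one of four rectangles, to its left, right, below or
    above, of total area [1 - h ^ 2]. *)
Lemma coverable_empty_rect (n : nat) (a b h : R) :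
  0 <= a -> 0 <= b -> 0 <= h -> a + h <= 1 -> b + h <= 1 ->
  coverable n (fun x => in_unit_square_n n x /\
      forall k, (k < n)%nat -> ~ in_rect ((a, b), (a + h, b + h)) (x k))
    ((1 - h ^ 2) ^ n).
Proof.
  intros Ha Hb Hh Hah Hbh.
  set (l := ((0, 0), (a, 1)) :: ((a + h, 0), (1, 1)) ::
            ((a, 0), (a + h, b)) :: ((a, b + h), (a + h, 1)) :: nil).
  destruct (coverable_pow n l) as (Bs & Hok & Hvol & Hcov).
  { intros c Hc. unfold l in Hc. simpl in Hc.
    repeat destruct Hc as [<-|Hc]; try contradiction; unfold rect_ok; simpl; lra. }
  exists Bs. split; [assumption|split].
  - rewrite Hvol. f_equal. unfold total, area, l. simpl. ring.
  - intros x [Hsq Hempty]. apply Hcov. intros k Hk.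
    specialize (Hsq k Hk). specialize (Hempty k Hk).
    unfold in_rect in *. simpl in Hempty.
    destruct (Rle_dec (fst (x k)) a).
    { eexists; split; [left; reflexivity|simpl; lra]. }
    destruct (Rle_dec (a + h) (fst (x k))).
    { eexists; split; [right; left; reflexivity|simpl; lra]. }
    destruct (Rle_dec (snd (x k)) b).
    { eexists; split; [right; right; left; reflexivity|simpl; lra]. }
    eexists; split; [right; right; right; left; reflexivity|simpl].
    split; [lra|]. split; [|lra].
    apply Rnot_lt_le. intros Hlt. apply Hempty. lra.
Qed.

Lemma grid_index (m : nat) (h u : R) :
  (0 < m)%nat -> 0 <= u <= INR m * h ->
  exists i, (i < m)%nat /\ INR i * h <= u <= INR i * h + h.
Proof.
  induction m as [|m IH]; intros Hm Hu; [lia|].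
  destruct (Rle_dec (INR m * h) u) as [Hle|Hlt].
  - exists m. split; [lia|]. rewrite S_INR in Hu. lra.
  - destruct m as [|m]; [simpl in Hlt; lra|].
    destruct IH as (i & Hi & H); [lia|lra|]. exists i. split; [lia|assumption].
Qed.

Lemma net_of_grid (n m : nat) (x : nat -> R * R) (h : R) :
  (0 < m)%nat -> INR m * h = 1 -> 0 <= h ->
  (forall i j, (i < m)%nat -> (j < m)%nat ->
     exists k, (k < n)%nat /\ in_rect (cell h i j) (x k)) ->
  net n x (2 * h).
Proof.
  intros Hm Hmh Hh Hcell z [Hz1 Hz2].
  destruct (grid_index m h (fst z)) as (i & Hi & Hiz); [assumption|lra|].
  destruct (grid_index m h (snd z)) as (j & Hj & Hjz); [assumption|lra|].
  destruct (Hcell i j Hi Hj) as (k & Hk & [H1 H2]). simpl in H1, H2.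
  exists k. split; [assumption|]. unfold dist2.
  assert ((fst z - fst (x k)) ^ 2 <= h ^ 2)
    by (destruct (Rle_dec 0 (fst z - fst (x k))); nra).
  assert ((snd z - snd (x k)) ^ 2 <= h ^ 2)
    by (destruct (Rle_dec 0 (snd z - snd (x k))); nra).
  nra.
Qed.

(** If no cell is empty the vertices form a [2 * h]-net and two cops win. So the bad event lies in
    the union, over the [m] by [m] cells, of the events that the cell is empty. *)
Lemma bad_event_outer_measure (n m : nat) (r h eps : R) :
  (0 < n)%nat -> (0 < m)%nat -> INR m * h = 1 -> 0 < r ->
  2 * h <= r ^ 2 / 50000 ->
  INR m * (INR m * (1 - h ^ 2) ^ n) < eps ->
  outer_measure_lt n (bad_event n r) eps.
Proof.
  intros Hn Hm Hmh Hr Hhr Heps.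
  assert (Hm1 : 0 < INR m) by (apply lt_0_INR; assumption).
  assert (Hh : 0 < h) by nra.
  assert (Hin : forall i, (i < m)%nat -> 0 <= INR i * h /\ INR i * h + h <= 1).
  { intros i Hi. pose proof (pos_INR i). pose proof (le_INR (S i) m Hi) as Hle.
    rewrite S_INR in Hle. split; nra. }
  destruct (coverable_union n m (fun i x => exists j, (j < m)%nat /\
      (in_unit_square_n n x /\
       forall k, (k < n)%nat -> ~ in_rect (cell h i j) (x k)))
      (INR m * (1 - h ^ 2) ^ n)) as (Bs & Hok & Hvol & Hcov).
  { intros i Hi. apply (coverable_union n m (fun j x => in_unit_square_n n x /\
      forall k, (k < n)%nat -> ~ in_rect (cell h i j) (x k))).
    intros j Hj. destruct (Hin i Hi), (Hin j Hj).
    apply coverable_empty_rect; lra. }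
  apply coverable_outer_measure_lt with (INR m * (INR m * (1 - h ^ 2) ^ n)); auto.
  exists Bs. split; [assumption|split; [assumption|]].
  intros x [Hsq Hbad]. apply Hcov. apply NNPP. intros Hno. apply Hbad.
  apply two_cops_win with (2 * h); try assumption; [lra|].
  apply net_of_grid with m; auto; [lra|].
  intros i j Hi Hj. apply NNPP. intros Hempty. apply Hno.
  exists i. split; [assumption|]. exists j. split; [assumption|].
  split; [assumption|]. intros k Hk Hin'. apply Hempty. exists k. auto.
Qed.

(** * Logarithmic estimates and the choice of the grid *)

Lemma exp_mult_INR (n : nat) (v : R) : exp v ^ n = exp (INR n * v).
Proof.
  induction n as [|n IH]; [simpl; rewrite Rmult_0_l, exp_0; reflexivity|].
  rewrite S_INR, <- tech_pow_Rmult, IH, <- exp_plus. f_equal. ring.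
Qed.

(** [exp v] is the square of [exp (v / 2) >= 1 + v / 2], and [(1 + v / 2) ^ 2 - 2 * v = (1 - v / 2)
    ^ 2]. *)
Lemma exp_ge_double (v : R) : 0 <= v -> 2 * v <= exp v.
Proof.
  intros Hv. replace v with (v / 2 + v / 2) at 2 by field. rewrite exp_plus.
  pose proof (exp_ineq1_le (v / 2)). pose proof (pow2_ge_0 (1 - v / 2)). nra.
Qed.

Lemma ln_INR_bounds (n : nat) : (2 <= n)%nat -> 1 <= 2 * ln (INR n) <= INR n.
Proof.
  intros Hn. pose proof (le_INR 2 n Hn) as H2. simpl in H2.
  assert (Hl : / 2 < ln (INR n)).
  { apply Rlt_le_trans with (ln 2); [apply ln_lt_2|].
    destruct (Rle_lt_or_eq_dec 2 (INR n)) as [H|<-]; [lra| |lra].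
    apply Rlt_le, ln_increasing; lra. }
  pose proof (exp_ge_double (ln (INR n)) ltac:(lra)) as He.
  rewrite exp_ln in He by lra. lra.
Qed.

Theorem theorem4 :
  exists K1 : R, 0 < K1 /\
    forall r : nat -> R,
      (forall n : nat, (2 <= n)%nat ->
         r n >= K1 * Rpower (ln (INR n) / INR n) (/ 4)) ->
      forall eps : R, 0 < eps ->
        exists N : nat, forall n : nat, (N <= n)%nat ->
          outer_measure_lt n (bad_event n (r n)) eps.
Proof.
  (* With [g ^ 4 = ln n / n] and [m * g ^ 2 >= / 4], this constant gives
     [r ^ 2 / 50000 >= 20 * g ^ 2 >= 5 / m], enough for [d = 2 / m]. *)
  exists 1000. split; [lra|]. intros r Hr eps Heps.
  destruct (nat_ceiling (/ eps)) as (N & HN & _).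
  { apply Rlt_le, Rinv_0_lt_compat, Heps. }
  exists (N + 2)%nat. intros n Hn.
  specialize (Hr n ltac:(lia)).
  destruct (ln_INR_bounds n ltac:(lia)) as [Hln1 Hln2].
  pose proof (le_INR N n ltac:(lia)) as HNn.
  set (q := ln (INR n) / INR n) in *. set (g := Rpower q (/ 4)) in *.
  assert (Hq : 0 < q) by (apply Rdiv_lt_0_compat; lra).
  assert (Hg : 0 < g) by apply exp_pos.
  assert (Hg4 : g ^ 4 = q).
  { unfold g. rewrite <- Rpower_pow by apply exp_pos. rewrite Rpower_mult.
    replace (/ 4 * INR 4) with 1 by (simpl; field). apply Rpower_1, Hq. }
  set (s := sqrt (/ (2 * q))).
  assert (Hs2 : s ^ 2 = / (2 * q)).
  { unfold s. apply pow2_sqrt. apply Rlt_le, Rinv_0_lt_compat. lra. }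
  assert (Hs1 : 1 <= s).
  { rewrite <- sqrt_1. apply sqrt_le_1_alt. rewrite <- Rinv_1.
    apply Rinv_le_contravar; [lra|].
    apply Rmult_le_reg_r with (INR n); [lra|].
    unfold q. field_simplify; lra. }
  destruct (nat_ceiling s) as (m' & Hm1 & Hm2); [lra|].
  (* Stepping back by one gives [s - 1 < m <= s]. Since [m >= 1] as well, [m] is at least
     [s / 2]. *)
  destruct m' as [|m]; [simpl in Hm1; lra|]. rewrite S_INR in Hm1, Hm2.
  assert (Hm : (0 < m)%nat) by (apply INR_lt; simpl; lra).
  pose proof (le_INR 1 m Hm) as Hm3. simpl in Hm3.
  assert (Hsg : / 2 <= s * g ^ 2).
  { assert ((s * g ^ 2) ^ 2 = / 2).
    { rewrite Rpow_mult_distr, Hs2. replace ((g ^ 2) ^ 2) with (g ^ 4) by ring.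
      rewrite Hg4. field. lra. }
    assert (0 < s * g ^ 2) by (apply Rmult_lt_0_compat; [lra|apply pow_lt, Hg]).
    nra. }
  assert (Hmg : / 4 <= INR m * g ^ 2).
  { pose proof (pow_lt g 2 Hg). nra. }
  assert (Hr2 : 1000000 * g ^ 2 <= r n ^ 2).
  { assert ((1000 * g) ^ 2 <= r n ^ 2) by (apply sq_between; lra). lra. }
  apply bad_event_outer_measure with m (/ INR m); try lia; try lra.
  - field. lra.
  - apply Rmult_le_reg_r with (INR m); [lra|]. field_simplify; [|lra]. nra.
  - assert (Hnm : 2 * ln (INR n) <= INR n * (/ INR m) ^ 2).
    { assert (Hmm : INR m ^ 2 <= / (2 * q)) by (rewrite <- Hs2; nra).
      assert (Hmm' : INR m ^ 2 * (2 * q) <= 1).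
      { apply Rmult_le_reg_r with (/ (2 * q)).
        { apply Rinv_0_lt_compat. lra. }
        rewrite Rmult_assoc, Rinv_r by lra. lra. }
      apply Rmult_le_reg_r with (INR m ^ 2 / INR n).
      { apply Rdiv_lt_0_compat; [apply pow_lt|]; lra. }
      unfold q in Hmm'. field_simplify; [|lra|lra]. field_simplify in Hmm'; lra. }
    assert (Hinv : 0 < / INR m <= 1).
    { split; [apply Rinv_0_lt_compat; lra|].
      rewrite <- Rinv_1. apply Rinv_le_contravar; lra. }
    (* From [1 - t <= exp (- t)] and [n / m ^ 2 >= 2 * ln n]. With at most [n] cells the total is at
       most [1 / n], which is below [eps]. *)
    assert (Hpow : (1 - (/ INR m) ^ 2) ^ n <= / INR n * / INR n).
    { apply Rle_trans with (exp (- (/ INR m) ^ 2) ^ n).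
      - apply pow_incr. split; [nra|].
        pose proof (exp_ineq1_le (- (/ INR m) ^ 2)). lra.
      - rewrite exp_mult_INR. apply Rle_trans with (exp (- ln (INR n) + - ln (INR n))).
        + destruct (Rle_lt_or_eq_dec (INR n * - (/ INR m) ^ 2)
                      (- ln (INR n) + - ln (INR n))) as [H|H]; [lra| |].
          * apply Rlt_le, exp_increasing, H.
          * rewrite H. lra.
        + rewrite exp_plus, exp_Ropp, exp_ln by lra. lra. }
    assert (Hm2n : INR m * INR m <= INR n).
    { assert (E : (/ INR m) ^ 2 * (INR m * INR m) = 1) by (field; lra).
      assert (0 < INR m * INR m) by nra. nra. }
    apply Rle_lt_trans with (INR n * (/ INR n * / INR n)).
    + rewrite <- Rmult_assoc. apply Rmult_le_compat; try assumption; [nra|].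
      apply pow_le. nra.
    + replace (INR n * (/ INR n * / INR n)) with (/ INR n) by (field; lra).
      rewrite <- (Rinv_inv eps). apply Rinv_lt_contravar; [|lra].
      apply Rmult_lt_0_compat; [apply Rinv_0_lt_compat, Heps|lra].
Qed.
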